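(* Let $N,r,n$ be positive integers. Then $$ c_{N,n}^{(r)}=n!\,\det\left( \begin{array}{ccccc} D_r(1)&1&&&\\ D_r(2)&D_r(1)&&&\\ \vdots&\vdots&\ddots&1&\\ D_r(n-1)&D_r(n-2)&\cdots&D_r(1)&1\\ D_r(n)&D_r(n-1)&\cdots&D_r(2)&D_r(1) \end{array} \right), $$ i.e. the $n\times n$ matrix with $(i,j)$ entry $D_r(i-j+1)$ for $j\le i$, $1$ for $j=i+1$, and $0$ for $j\ge i+2$; here $$ D_r(e)=\sum_{\substack{i_1+\cdots+i_r=e\\ i_1,\dots,i_r\ge 0}}\frac{N^r}{(N+i_1)\cdots(N+i_r)}. $$
   Context: For positive integers $N$ and $r$, the (multiple) hypergeometric Cauchy numbers $c_{N,n}^{(r)}$ ($n\ge0$) are defined by the formal power series identity $$\frac{1}{\bigl({}_2F_1(1,N;N+1;-x)\bigr)^r}=\left(\frac{(-1)^{N-1}x^N/N}{\log(1+x)-\sum_{k=1}^{N-1}(-1)^{k-1}x^k/k}\right)^r=\sum_{n=0}^\infty c_{N,n}^{(r)}\frac{x^n}{n!},$$ where ${}_2F_1(a,b;c;z)=\sum_{n\ge0}\frac{(a)^{(n)}(b)^{(n)}}{(c)^{(n)}}\frac{z^n}{n!}$ is the Gauss hypergeometric function and $(x)^{(n)}=x(x+1)\cdots(x+n-1)$, $(x)^{(0)}=1$. *)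

(* Defs.v *)
From HB Require Import structures.
From mathcomp Require Import all_boot all_order all_algebra.

Set Implicit Arguments.
Unset Strict Implicit.
Unset Printing Implicit Defensive.

Import Order.TTheory GRing.Theory Num.Theory.

Local Open Scope ring_scope.

(* A formal power series over R is its coefficient sequence:                  *)
(* f : fps R stands for \sum_(n >= 0) f n * x^n.  Series are compared with =1 *)
Definition fps (R : Type) : Type := nat -> R.

Section FormalPowerSeries.
Variable R : fieldType.
Implicit Types f g : fps R.

Definition fps_one : fps R := fun n => (n == 0%N)%:R.

Definition fps_mul f g : fps R := fun n => \sum_(k < n.+1) f k * g (n - k)%N.

Definition fps_exp f (r : nat) : fps R := iter r (fps_mul f) fps_one.

(* The first n coefficients of 1 / f, each obtained by solving for g m in     *)
(* \sum_(k <= m) f (m - k) * g k = (m == 0)%:R.                               *)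
Fixpoint fps_inv_coefs f (n : nat) : seq R :=
  if n is m.+1 then
    let s := fps_inv_coefs f m in
    rcons s ((f 0%N)^-1 * ((m == 0%N)%:R - \sum_(k < m) f (m - k)%N * s`_k))
  else [::].

Definition fps_inv f : fps R := fun n => (fps_inv_coefs f n.+1)`_n.

(* f (- x) *)
Definition fps_compN f : fps R := fun n => (-1) ^+ n * f n.

(* \sum_n a n * x^n / n! *)
Definition fps_egf (a : nat -> R) : fps R := fun n => a n / (n`!)%:R.

Definition rising (x : R) (n : nat) : R := \prod_(i < n) (x + i%:R).

Definition hypergeom_2F1 (a b c : R) : fps R :=
  fps_egf (fun n => rising a n * rising b n / rising c n).

Lemma size_fps_inv_coefs f n : size (fps_inv_coefs f n) = n.
Proof. by elim: n => //= n IHn; rewrite size_rcons IHn. Qed.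

Lemma nth_fps_inv_coefs f n k : (k < n)%N -> (fps_inv_coefs f n)`_k = fps_inv f k.
Proof.
elim: n => // n IHn; rewrite ltnS leq_eqVlt => /predU1P[-> // | lt_kn].
by rewrite /= nth_rcons size_fps_inv_coefs lt_kn IHn.
Qed.

Lemma fps_invE f n :
  fps_inv f n =
  (f 0%N)^-1 * ((n == 0%N)%:R - \sum_(k < n) f (n - k)%N * fps_inv f k).
Proof.
rewrite {1}/fps_inv /= nth_rcons size_fps_inv_coefs ltnn eqxx.
by under eq_bigr => k _ do rewrite nth_fps_inv_coefs //.
Qed.

Lemma fps_mulV f : f 0%N != 0 -> fps_mul (fps_inv f) f =1 fps_one.
Proof.
move=> f0 n; rewrite /fps_mul /fps_one big_ord_recr /= subnn.
rewrite fps_invE mulrC mulVKf // addrC.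
by rewrite -[RHS](subrK (\sum_(k < n) f (n - k)%N * fps_inv f k)); congr (_ + _);
  apply: eq_bigr => k _; rewrite mulrC.
Qed.

End FormalPowerSeries.

Definition hyper_cauchy_series (N r : nat) : fps rat :=
  fps_inv
    (fps_exp (fps_compN (hypergeom_2F1 (1 : rat) N%:R N.+1%:R)) r).

Definition hyper_cauchy (N r n : nat) : rat :=
  (n`!)%:R * hyper_cauchy_series N r n.

Lemma hyper_cauchy_egf (N r : nat) :
  fps_egf (hyper_cauchy N r) =1 hyper_cauchy_series N r.
Proof.
move=> n; rewrite /fps_egf /hyper_cauchy mulrAC mulfV ?mul1r //.
by rewrite pnatr_eq0 -lt0n fact_gt0.
Qed.

Lemma rising1 n : rising (1 : rat) n = (n`!)%:R.
Proof.
elim: n => [|n IHn]; rewrite /rising ?big_ord0 // big_ord_recr /=.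
by rewrite -/(rising _ _) IHn factS natrM mulrC nat1r.
Qed.

Lemma risingS (N n : nat) :
  (0 < N)%N ->
  rising (N%:R : rat) n / rising (N.+1%:R : rat) n = N%:R / (N + n)%:R.
Proof.
move=> N0; have nz m : ((N + m)%:R : rat) != 0.
  by rewrite pnatr_eq0 -lt0n addn_gt0 N0.
elim: n => [|n IHn].
  by have := nz 0%N; rewrite /rising !big_ord0 addn0 divr1 => /mulfV ->.
rewrite /rising !big_ord_recr /= -!/(rising _ _) invfM mulrACA IHn.
by rewrite -!natrD addSnnS mulrA mulfVK.
Qed.

Lemma hyper_2F1E (N n : nat) : (0 < N)%N ->
  hypergeom_2F1 (1 : rat) N%:R N.+1%:R n = N%:R / (N + n)%:R.
Proof.
move=> N0; rewrite /hypergeom_2F1 /fps_egf rising1 -(mulrA _ (rising _ _)).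
by rewrite risingS // mulrC mulKf // pnatr_eq0 -lt0n fact_gt0.
Qed.

Lemma hyper_cauchy_mul (N r : nat) : (0 < N)%N ->
  fps_mul (fps_egf (hyper_cauchy N r))
    (fps_exp (fps_compN (hypergeom_2F1 (1 : rat) N%:R N.+1%:R)) r)
  =1 @fps_one rat.
Proof.
move=> N0 n; set F := fps_exp _ r.
have F0 : F 0%N != 0.
  rewrite /F; elim: r {F} => [|r IHr]; first exact: oner_neq0.
  rewrite /fps_exp iterS -/(fps_exp _ r) /fps_mul big_ord1 mulf_neq0 //.
  by rewrite /fps_compN mul1r hyper_2F1E // addn0 mulfV ?oner_neq0 ?pnatr_eq0 -?lt0n.
rewrite -(fps_mulV F0 n); apply: eq_bigr => k _.
by rewrite hyper_cauchy_egf.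
Qed.

(* log (1 + x) = \sum_(k >= 1) (-1)^(k - 1) x^k / k                           *)
Definition fps_log1p : fps rat :=
  fun k => if k == 0%N then 0 else (-1) ^+ k.-1 / k%:R.

(* The tail log (1 + x) - \sum_(1 <= k < N) (-1)^(k - 1) x^k / k              *)
Definition fps_log1p_tail (N : nat) : fps rat :=
  fun n => fps_log1p n -
    \sum_(1 <= k < N) (-1) ^+ k.-1 / k%:R * (n == k)%:R.

(* (-1)^(N - 1) x^N / N *)
Definition fps_lead (N : nat) : fps rat :=
  fun n => (-1) ^+ N.-1 / N%:R * (n == N)%:R.

(* Hence 1 / 2F1(1, N; N + 1; - x) is the quotient                            *)
(* ((-1)^(N - 1) x^N / N) / (log (1 + x) - \sum_(1 <= k < N) ...).            *)
Lemma log1p_tailE (N : nat) : (0 < N)%N ->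
  fps_log1p_tail N =1
  fps_mul (fps_lead N) (fps_compN (hypergeom_2F1 (1 : rat) N%:R N.+1%:R)).
Proof.
move=> N0 n; rewrite /fps_mul /fps_log1p_tail /fps_lead.
have -> : \sum_(1 <= k < N) ((-1) ^+ k.-1 / k%:R * (n == k)%:R : rat) =
          if (0 < n < N)%N then (-1) ^+ n.-1 / n%:R else 0.
  case: ifP => nN.
    rewrite (bigD1_seq n) ?mem_index_iota ?iota_uniq //= eqxx mulr1.
    by rewrite big1 ?addr0 // => k /negPf; rewrite eq_sym => ->; rewrite mulr0.
  rewrite big_seq big1 // => k; rewrite mem_index_iota => kN.
  by case: eqP kN nN => [-> ->|]; rewrite ?mulr0.
case: (leqP N n) => [leNn | ltnN]; last first.
  rewrite big1 => [|k _]; last first.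
    by rewrite ltn_eqF ?mulr0 ?mul0r // (leq_ltn_trans _ ltnN) // -ltnS.
  by rewrite andbT /fps_log1p; case: n {ltnN} => [|n] /=; rewrite subrr.
rewrite andbF subr0 (bigD1 (Ordinal (leNn : (N < n.+1)%N))) //= eqxx mulr1.
rewrite [X in _ + X]big1 ?addr0 => [|k]; last first.
  by rewrite -val_eqE /= => /negPf ->; rewrite mulr0 mul0r.
rewrite /fps_compN hyper_2F1E // subnKC // /fps_log1p.
have n0 : (0 < n)%N := leq_trans N0 leNn.
rewrite gtn_eqF // mulrACA -exprD mulKf ?pnatr_eq0 -?lt0n //.
congr (_ ^+ _ / _); case: N N0 leNn => // N _ ltNn.
by rewrite /= subnS -subn1 -[in RHS]subn1 addnBA ?subn_gt0 // subnKC 1?ltnW.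
Qed.

(* D_r(e); each i_j is at most e since the i_j are nonnegative with sum e.    *)
Definition Dsum (N r e : nat) : rat :=
  \sum_(i : {ffun 'I_r -> 'I_e.+1} | (\sum_(j < r) i j)%N == e)
    N%:R ^+ r / \prod_(j < r) (N + i j)%:R.

(* Indices are 0-based; the entries only depend on i - j.                     *)
Definition cauchy_mx (N r n : nat) : 'M[rat]_n :=
  \matrix_(i < n, j < n)
    if (j <= i)%N then Dsum N r (i - j + 1)
    else if (j == i + 1 :> nat)%N then 1 else 0.

(* Main.v *)
Require Import Defs.
From mathcomp Require Import all_boot all_order all_algebra.

Import GRing.Theory.

Local Open Scope ring_scope.

(** Let [a] be the series with coefficients [Dsum N r], that is the [r]-th power
    of 2F1(1, N; N + 1; x).  If [L] is the unipotent lower triangular Toeplitz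
    matrix of order n + 1 with entries a (i - j), then the first column of its
    inverse lists the coefficients of 1 / a, so Cramer's rule gives the last one
    as (-1)^n times the minor of [L] omitting the first row and the last column.
    This minor is the Hessenberg determinant of the theorem, and the substitution
    of - x for x absorbs the sign. *)

(** Coefficients up to [m] of a power ignore the terms of [f] beyond [m], so truncating [f] makes
    polynomial algebra available. *)
Lemma coef_poly_exp_fps (R : fieldType) (f : fps R) (m r e : nat) : (e <= m)%N ->
  ((\poly_(k < m.+1) f k) ^+ r)`_e = fps_exp f r e.
Proof.
elim: r e => [|r IHr] e lem; first by rewrite expr0 coef1.
rewrite exprS coefM /fps_exp iterS -/(fps_exp f r) /fps_mul.
apply: eq_bigr => k _; have lekm : (k <= m)%N by exact: leq_trans (leq_ord k) lem.
by rewrite coef_poly ltnS lekm IHr // (leq_trans (leq_subr _ _)).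
Qed.

Lemma fps_exp_sum_ffun (R : fieldType) (f : fps R) (r e : nat) :
  fps_exp f r e =
  \sum_(i : {ffun 'I_r -> 'I_e.+1} | (\sum_(j < r) i j)%N == e)
    \prod_(j < r) f (i j).
Proof.
(* Truncating at degree [e] makes the expanded power range over exactly the functions into
   ['I_e.+1]. *)
rewrite -(@coef_poly_exp_fps _ _ e) // poly_def -[r in LHS]card_ord -prodr_const.
rewrite bigA_distr_bigA coef_sum [RHS]big_mkcond; apply: eq_bigr => i _ /=.
rewrite scaler_prod -(expr_sum 'X) coefZ coefXn eq_sym.
by case: eqP => _; rewrite ?mulr1 ?mulr0.
Qed.

Lemma fps_exp_compN (R : fieldType) (f : fps R) (r n : nat) :
  fps_exp (fps_compN f) r n = fps_compN (fps_exp f r) n.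
Proof.
rewrite /fps_compN !fps_exp_sum_ffun mulr_sumr; apply: eq_bigr => i /eqP sum_i.
by rewrite big_split /= -expr_sum sum_i.
Qed.

Lemma eq_fps_inv (R : fieldType) (f g : fps R) : f =1 g -> fps_inv f =1 fps_inv g.
Proof.
move=> eq_fg n; rewrite /fps_inv; congr (_`_n).
elim: n.+1 => //= m ->; rewrite eq_fg; congr (rcons _ (_ * (_ - _))).
by apply: eq_bigr => k _; rewrite eq_fg.
Qed.

Lemma fps_inv_compN_det (R : fieldType) (a : fps R) (n : nat) : a 0%N = 1 ->
  fps_inv (fps_compN a) n =
  \det (\matrix_(i < n, j < n) if (j <= i.+1)%N then a (i.+1 - j)%N else 0).
Proof.
move=> a0; set g := fps_inv (fps_compN a).
pose L : 'M[R]_n.+1 := \matrix_(i, j) if (j <= i)%N then a (i - j)%N else 0.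
(* Since [g] is 1 / a(- x), the entries of [v] are the coefficients of 1 / a(x). *)
pose v : 'cV[R]_n.+1 := \col_i ((-1) ^+ i * g i).
have detL : \det L = 1.
  rewrite det_trig; last first.
    by apply/is_trig_mxP => i j ltij; rewrite mxE leqNgt ltij.
  by rewrite big1 // => i _; rewrite mxE leqnn subnn.
have Lv : L *m v = delta_mx 0 0.
  apply/colP => i; rewrite !mxE eqxx andbT -val_eqE /=.
  have f0 : fps_compN a 0%N != 0 by rewrite /fps_compN a0 mulr1 oner_neq0.
  transitivity ((-1) ^+ i * fps_mul g (fps_compN a) i); last first.
    by rewrite fps_mulV // /fps_one; case: eqP => [->|]; rewrite ?mulr1 ?mulr0.
  rewrite /fps_mul mulr_sumr.
  rewrite (big_ord_widen n.+1 (fun k => (-1) ^+ i * (g k * fps_compN a (i - k)%N)))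
    ?ltn_ord // [RHS]big_mkcond.
  apply: eq_bigr => j _; rewrite !mxE ltnS; case: leqP => leji; last by rewrite mul0r.
  rewrite /fps_compN mulrCA [a _ * _]mulrC [g j * (_ * _)]mulrCA [RHS]mulrA -exprD.
  congr (_ * _).
  (* For j <= i, the exponents j and i + (i - j) have the same parity. *)
  by rewrite -signr_odd -[RHS]signr_odd oddD oddB // addKb.
have : v ord_max 0 = cofactor L 0 ord_max.
  have -> : v = \adj L *m delta_mx 0 0.
    by rewrite -Lv mulmxA mul_adj_mx detL mul1mx.
  by rewrite -colE !mxE.
(* The cofactor sign (-1)^(0 + n) cancels the sign in the last entry of [v]. *)
rewrite mxE /cofactor add0n => /(can_inj (signrMK n)) ->.
congr (\det _); apply/matrixP => i j.
by rewrite !mxE lift0 lift_max.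
Qed.

Lemma DsumE (N r e : nat) : (0 < N)%N ->
  Dsum N r e = fps_exp (hypergeom_2F1 (1 : rat) N%:R N.+1%:R) r e.
Proof.
move=> N0; rewrite fps_exp_sum_ffun; apply: eq_bigr => i _.
under [RHS]eq_bigr => j _ do rewrite hyper_2F1E //.
by rewrite big_split /= prodr_const card_ord prodfV.
Qed.

Lemma Dsum0 (N r : nat) : (0 < N)%N -> Dsum N r 0 = 1.
Proof.
move=> N0; rewrite DsumE //; elim: r => // r IHr.
rewrite /fps_exp iterS -/(fps_exp _ r) /fps_mul big_ord1 IHr mulr1 hyper_2F1E //.
by rewrite addn0 mulfV // Num.Theory.pnatr_eq0 -lt0n.
Qed.

Theorem theorem2 (N r n : nat) (hN : (0 < N)%N) (hr : (0 < r)%N) (hn : (0 < n)%N) :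
  hyper_cauchy N r n = (n`!)%:R * \det (cauchy_mx N r n).
Proof.
rewrite /hyper_cauchy /hyper_cauchy_series; congr (_ * _).
rewrite (eq_fps_inv _ _ (fps_compN (Dsum N r))) => [|k]; last first.
  by rewrite fps_exp_compN /fps_compN DsumE.
rewrite fps_inv_compN_det ?Dsum0 //; congr (\det _).
apply/matrixP => i j; rewrite !mxE !addn1.
case: (ltngtP j i) => [ltji|ltij|eqji].
- by rewrite (leqW (ltnW ltji)) subSn // ltnW.
(* On the superdiagonal j = i + 1, the explicit entry 1 is [Dsum N r 0]. *)
- by case: (ltngtP j i.+1) ltij => // ->; rewrite subnn Dsum0.
- by rewrite eqji leqnSn subSn.
Qed.
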